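(* Let $z>0$, let $(P_n)_{n\ge0}$ be the monic orthogonal polynomials with respect to $\langle \mathbf{u}_z,p\rangle=\int_0^\infty p(x)e^{-zx^4}\,dx$, with recurrence coefficients $a_n,b_n$, and let $h_n=\langle\mathbf{u}_z,P_n^2\rangle$. For every $n\ge1$, the zeros $x_{n,1}<\dots<x_{n,n}$ of $P_n$ are equilibrium positions of $n$ unit-charged particles distributed along $(0,\infty)$ under the influence of the external potential $$V_n(x)=zx^4+\ln\left|x\left(x^2+b_nx+a_{n+1}+b_n^2+a_n\right)+\frac{P_n^2(0)}{4zh_n}\right|-\ln|x|,$$ that is, $(y_1,\dots,y_n)=(x_{n,1},\dots,x_{n,n})$ satisfies $\dfrac{\partial E_n}{\partial y_k}=0$ for $k=1,\dots,n$, where $$E_n(y_1,\dots,y_n)=-2\sum_{1\le j<k\le n}\ln|y_k-y_j|+\sum_{k=1}^nV_n(y_k).$$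
   Context: The functional $\mathbf{u}_z$ is positive definite, so the zeros of $P_n$ are real, simple and lie in $(0,\infty)$. The coefficients $a_n$ ($n\ge1$) and $b_n$ ($n\ge0$) are defined by $xP_n(x)=P_{n+1}(x)+b_nP_n(x)+a_nP_{n-1}(x)$, $n\ge0$, with $P_{-1}=0$, $P_0=1$. In $V_n$ and $E_n$ the numbers $a_n,a_{n+1},b_n,h_n,P_n(0)$ are fixed constants. ''Equilibrium position'' means a critical point of the total energy $E_n$, with logarithmic interaction between particles. *)

(* Defs.v *)
From HB Require Import structures.
From mathcomp Require Import all_boot all_order all_algebra.
From mathcomp Require Import all_classical all_reals all_analysis.

Set Implicit Arguments.
Unset Strict Implicit.
Unset Printing Implicit Defensive.

Import Order.TTheory GRing.Theory Num.Theory.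
Import numFieldNormedType.Exports.

Local Open Scope classical_set_scope.
Local Open Scope ring_scope.

(* The functional u_z : p |-> \int_0^oo p(x) exp(- z x^4) dx.  For z > 0 the
   integrand is integrable, so the real-valued integral is never a default
   value. *)
Definition quartic_functional (R : realType) (z : R) (p : {poly R}) : R :=
  \int[@lebesgue_measure R]_(x in `[0%R, +oo[) (p.[x] * expR (- (z * x ^+ 4))).

Definition monic_orthogonal (R : realType) (u : {poly R} -> R)
    (P : nat -> {poly R}) : Prop :=
  [/\ forall n, P n \is monic,
      forall n, size (P n) = n.+1,
      forall m n, m != n -> u (P m * P n) = 0
    & forall n, u (P n ^+ 2) != 0].

(* x P_n = P_{n+1} + b_n P_n + a_n P_{n-1} with P_{-1} = 0; the value of a_0 is
   thus unconstrained. *)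
Definition three_term_recurrence (R : realType) (P : nat -> {poly R})
    (a b : nat -> R) : Prop :=
  forall n, 'X * P n =
    P n.+1 + b n *: P n + a n *: (if n is m.+1 then P m else 0).

Definition external_potential (R : realType) (z : R) (P : nat -> {poly R})
    (a b h : nat -> R) (n : nat) (x : R) : R :=
  z * x ^+ 4
  + ln `|x * (x ^+ 2 + b n * x + a n.+1 + b n ^+ 2 + a n)
         + (P n).[0] ^+ 2 / (4 * z * h n)|
  - ln `|x|.

Definition total_energy (R : realType) (n : nat) (V : R -> R)
    (y : 'rV[R]_n) : R :=
  - 2 * (\sum_(j < n) \sum_(k < n | (j < k)%N) ln `|y 0 k - y 0 j|)
  + \sum_(k < n) V (y 0 k).

(* The k-th partial derivative is the derivative along the k-th vector of the
   canonical basis; is_derive asserts that it exists and equals 0. *)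
Definition critical_point (R : realType) (n : nat) (E : 'rV[R]_n -> R)
    (y : 'rV[R]_n) : Prop :=
  forall k : 'I_n, is_derive y (delta_mx 0 k : 'rV[R]_n) E 0.

(* x lists in increasing order all the real roots of p.  When p has degree n,
   this says that the zeros of p are real and simple. *)
Definition ordered_zeros (R : realType) (n : nat) (p : {poly R})
    (x : 'rV[R]_n) : Prop :=
  (forall j k : 'I_n, (j < k)%N -> x 0 j < x 0 k) /\
  (forall t : R, root p t <-> exists k : 'I_n, t = x 0 k).

(* Main.v *)
Require Import Defs.
From mathcomp Require Import all_boot all_order all_algebra.
From mathcomp Require Import all_classical all_reals all_analysis.
From mathcomp Require Import measurable_realfun ring lra.
From mathcomp Require polyrcf.
Import Order.TTheory GRing.Theory Num.Theory.
Import numFieldNormedType.Exports.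
Local Open Scope ring_scope.

(* Idea. Write [u] for the functional; integration by parts gives
   [u f' = 4 z u (x^3 f) - f(0)] for every polynomial [f]. Let [t] be a
   zero of [P_n] and [P_n = (x - t) q]. Then [u (q r) = u(q) r(t)] whenever
   [deg r < n], so integrating by parts [q P_n] and [q^2] yields
     [u (q^2) = 4 z h_n Phi(t) / t]   and
     [2 q'(t)/q(t) = 4 z t^3
        + (4 z h_n (b_n + 2 t) - P_n(0)^2 / t^2) / u (q^2)],
   where [Phi] is the polynomial inside the logarithm of the potential.
   Together they say [2 q'(t)/q(t) = V_n'(t)], which is the equilibrium
   condition since [q'(t)/q(t)] is the sum of [1/(t - x_j)] over the other
   zeros; the first one also shows [Phi(t) > 0]. That all zeros are simple and
   positive: multiplying [P_n] by [x - s] for its positive zeros [s] of odd order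
   makes it of constant sign, so there are [n] of them by orthogonality. *)

(** * Integration against the quartic weight *)

Section Analysis.
Local Open Scope classical_set_scope.
Local Open Scope ring_scope.
Variable R : realType.
Implicit Types (z x : R) (p q f : {poly R}).
Local Notation mu := (@lebesgue_measure R).

Lemma exprn_le_expR x n : 0 <= x -> x ^+ n <= n`!%:R * expR x.
Proof.
case: n => [|n] x0; first by rewrite expr0 fact0 mul1r -[leLHS]expR0 ler_expR.
rewrite -ler_pdivrMl ?ltr0n ?fact_gt0// mulrC.
by apply: le_trans (expR_ge1Dxn n x0); rewrite lerDr.
Qed.

Lemma horner_le_expR p : exists2 C, 0 <= C &
  forall x, 0 <= x -> `|p.[x]| <= C * expR x.
Proof.
exists (\sum_(i < size p) `|p`_i| * i`!%:R).
  by apply: sumr_ge0 => i _; rewrite mulr_ge0.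
move=> x x0; rewrite horner_coef mulr_suml.
apply: le_trans (ler_norm_sum _ _ _) _; apply: ler_sum => i _.
rewrite normrM -mulrA ler_wpM2l// ger0_norm ?exprn_ge0//.
exact: exprn_le_expR.
Qed.

Definition weighted z p x := p.[x] * expR (- (z * x ^+ 4)).

(** An exponential majorant is chosen because its primitive is explicit: it yields integrability,
    decay at infinity and the sign correction used in integrating by parts. *)
Lemma weighted_bound z p : 0 < z -> exists2 C, 0 <= C &
  forall x, 0 <= x -> `|weighted z p x| <= C * expR (- x).
Proof.
move=> z0; have [C C0 Cp] := horner_le_expR p.
exists (C * expR (z + z^-1)); first by rewrite mulr_ge0// expR_ge0.
move=> x x0; rewrite normrM (ger0_norm (expR_ge0 _)).
apply: (@le_trans _ _ (C * expR x * expR (- (z * x ^+ 4)))).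
  by rewrite ler_wpM2r ?expR_ge0 ?Cp.
rewrite -!mulrA -!expRD ler_wpM2l// ler_expR.
have zV : z * z^-1 = 1 by rewrite divff// gt_eqF.
set w := z^-1 in zV *.
(* Completing squares: [2 x <= z x^4 + z + z^-1]. *)
have : 0 <= z * (x ^+ 2 - 1) ^+ 2 + z * (x - w) ^+ 2 + z * x ^+ 2.
  by rewrite !addr_ge0// mulr_ge0 ?sqr_ge0// ltW.
have -> : z * (x ^+ 2 - 1) ^+ 2 + z * (x - w) ^+ 2 + z * x ^+ 2 =
  z + (z * w) * w - 2 * (z * w) * x + z * x ^+ 4 by ring.
by rewrite zV; lra.
Qed.

Lemma is_derive_weight z x :
  is_derive x 1 (fun x => expR (- (z * x ^+ 4)))
    (- (4 * z * x ^+ 3) * expR (- (z * x ^+ 4))).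
Proof.
have h : is_derive x 1 (horner (- (z *: 'X^4))) (- (4 * z * x ^+ 3)).
  apply: is_derive_eq (is_derive_poly _ x) _.
  rewrite derivN derivZ derivXn hornerN hornerZ -scaler_nat hornerZ hornerXn.
  by ring.
have := is_derive1_comp (is_derive_expR (horner (- (z *: 'X^4)) x)) h.
rewrite (_ : expR \o _ = fun x => expR (- (z * x ^+ 4))).
  by rewrite !hornerE mulrC.
by apply/funext => y /=; rewrite !hornerE.
Qed.

(** The derivative is again a polynomial times the weight, so integrating it gives a relation
    between values of the functional. *)
Lemma is_derive_weighted z p x :
  is_derive x 1 (weighted z p) (weighted z (p^`() - (4 * z) *: ('X^3 * p)) x).
Proof.
apply: is_derive_eq (is_deriveM (is_derive_poly p x) (is_derive_weight z x)) _.
by rewrite /weighted !hornerE /GRing.scale/=; ring.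
Qed.

Lemma is_derive_continuous (f g : R -> R) :
  (forall x, is_derive x 1 f (g x)) -> continuous f.
Proof.
move=> fg x; apply/differentiable_continuous/derivable1_diffP.
exact: (@ex_derive _ _ _ _ _ _ _ (fg x)).
Qed.

Lemma continuous_weighted z p : continuous (weighted z p).
Proof. exact: is_derive_continuous (is_derive_weighted z p). Qed.

(** * Fundamental theorem of calculus on the half-line *)

Lemma ge0_integraly_derive (F f : R -> R) (l : R) :
  (forall x, is_derive x 1 F (f x)) -> continuous f ->
  (forall x, 0 <= x -> 0 <= f x) -> F x @[x --> +oo] --> l ->
  (\int[mu]_(x in `[0%R, +oo[) (f x)%:E = (l - F 0)%:E)%E.
Proof.
move=> dF cf f0 Fl.
have cF := is_derive_continuous _ _ dF.
rewrite (@ge0_continuous_FTC2y R f F 0 l) //.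
- exact: continuous_subspaceT.
- exact/cvg_at_right_filter/cF.
- by move=> x _; rewrite derive1E; apply: derive_val.
Qed.

Lemma ge0_integrabley_derive (F f : R -> R) (l : R) :
  (forall x, is_derive x 1 F (f x)) -> continuous f ->
  (forall x, 0 <= x -> 0 <= f x) -> F x @[x --> +oo] --> l ->
  mu.-integrable `[0%R, +oo[ (EFin \o f).
Proof.
move=> dF cf f0 Fl; apply/integrableP; split.
  by apply/measurable_EFinP/measurable_funTS; exact: continuous_measurable_fun.
under eq_integral => x.
  rewrite inE/= in_itv/= andbT => x0.
  rewrite ger0_norm ?f0//.
  over.
by rewrite (ge0_integraly_derive F f l)// ltry.
Qed.

Lemma is_derive_expN C x :
  is_derive x 1 (fun x => - C * expR (- x)) (C * expR (- x)).
Proof.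
have h : is_derive x 1 (fun x => expR (- x)) (- expR (- x)).
  apply: is_derive_eq (is_derive1_comp (is_derive_expR (- x)) _) _.
  by rewrite mulrN1.
apply: is_derive_eq (is_deriveZ (- C) h) _.
by rewrite /GRing.scale/= mulrNN.
Qed.

Lemma cvgy_expN C : C * expR (- x) @[x --> +oo] --> (0 : R).
Proof.
by rewrite -(mulr0 C); apply: cvgM; [exact: cvg_cst|exact: cvgr_expR].
Qed.

Lemma continuous_expN C : continuous (fun x : R => C * expR (- x)).
Proof.
move=> x; apply: cvgM; first exact: cvg_cst.
apply: continuous_comp; last exact: continuous_expR.
exact: continuousN.
Qed.

Lemma integrable_expN C : 0 <= C ->
  mu.-integrable `[0%R, +oo[ (EFin \o (fun x => C * expR (- x))).
Proof.
move=> C0; apply: (ge0_integrabley_derive _ _ 0 (is_derive_expN C)).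
- exact: continuous_expN.
- by move=> x _; rewrite mulr_ge0// expR_ge0.
- exact: cvgy_expN.
Qed.

Lemma integrable_weighted z p : 0 < z ->
  mu.-integrable `[0%R, +oo[ (EFin \o weighted z p).
Proof.
move=> z0; have [C C0 Cp] := weighted_bound z p z0.
apply: le_integrable (integrable_expN C C0) => //.
  apply/measurable_EFinP; apply: measurable_funTS.
  by apply: continuous_measurable_fun; exact: continuous_weighted.
move=> x /=; rewrite in_itv/= andbT => x0; rewrite lee_fin.
by apply: le_trans (Cp x x0) _; exact: ler_norm.
Qed.

Lemma quartic_functionalE z p :
  quartic_functional z p = \int[mu]_(x in `[0%R, +oo[) weighted z p x.
Proof. by []. Qed.

Lemma quartic_functionalD z p q : 0 < z ->
  quartic_functional z (p + q) =
  quartic_functional z p + quartic_functional z q.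
Proof.
move=> z0; rewrite !quartic_functionalE.
under eq_Rintegral do rewrite /weighted hornerD mulrDl.
by rewrite RintegralD//; exact: integrable_weighted.
Qed.

Lemma quartic_functionalZ z c p : 0 < z ->
  quartic_functional z (c *: p) = c * quartic_functional z p.
Proof.
move=> z0; rewrite !quartic_functionalE.
under eq_Rintegral do rewrite /weighted hornerZ -mulrA.
by rewrite RintegralZl//; exact: integrable_weighted.
Qed.

Lemma cvgy_weighted z p : 0 < z -> weighted z p x @[x --> +oo] --> (0 : R).
Proof.
move=> z0; have [C C0 Cp] := weighted_bound z p z0.
apply/norm_cvg0P.
apply: (squeeze_cvgr _ (cvg_cst 0) (cvgy_expN C)).
near=> x; rewrite normr_ge0/=; apply: Cp.
by near: x; exact: nbhs_pinfty_ge.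
Unshelve. all: by end_near. Qed.

(* FTC on the half-line needs a sign: apply it to [F' + C e^-x] and [C e^-x]. *)
Lemma quartic_functional_deriv z p : 0 < z ->
  quartic_functional z p^`() =
    4 * z * quartic_functional z ('X^3 * p) - p.[0].
Proof.
move=> z0; pose q := p^`() - (4 * z) *: ('X^3 * p).
have [C C0 Cq] := weighted_bound z q z0.
(* By linearity the claim is that [weighted z q], the derivative of [weighted z p], integrates to
   minus the boundary value at [0]. *)
suff E : quartic_functional z q = - p.[0].
  have -> : p^`() = q + (4 * z) *: ('X^3 * p) by rewrite subrK.
  by rewrite quartic_functionalD// quartic_functionalZ// E addrC.
have iC := integrable_expN C C0.
have iq := integrable_weighted z q z0.
rewrite quartic_functionalE.
have -> : \int[mu]_(x in `[0%R, +oo[) weighted z q x =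
   \int[mu]_(x in `[0%R, +oo[) (weighted z q x + C * expR (- x)) -
   \int[mu]_(x in `[0%R, +oo[) (C * expR (- x)).
  by rewrite RintegralD// addrK.
have dG x : is_derive x 1 (weighted z p \+ (fun x => - C * expR (- x)))
    (weighted z q x + C * expR (- x)).
  exact: is_deriveD (is_derive_weighted z p x) (is_derive_expN C x).
rewrite /Rintegral (ge0_integraly_derive _ _ (0 + 0) dG); first last.
- by apply: cvgD; [exact: cvgy_weighted|exact: cvgy_expN].
- move=> x x0; rewrite -lerBlDr sub0r.
  by have /ler_normlP[] := Cq x x0; rewrite lerNl.
- by move=> x; apply: cvgD; [exact: continuous_weighted|exact: continuous_expN].
rewrite (ge0_integraly_derive _ _ _ (is_derive_expN C) (continuous_expN C) _
  (cvgy_expN (- C))); last first.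
  by move=> x _; rewrite mulr_ge0// expR_ge0.
by rewrite /= /weighted expr0n/= mulr0 oppr0 expR0; ring.
Qed.

(** The first [size p] natural numbers cannot all be roots of a nonzero [p]. *)
Lemma poly_nonroot_ge0 p : p != 0 -> exists2 x : R, 0 <= x & ~~ root p x.
Proof.
move=> p0; apply/not_exists2P => H.
pose s := [seq (i%:R : R) | i <- iota 0 (size p)].
have : (size s < size p)%N.
  apply: max_poly_roots => //; last first.
    by rewrite map_inj_uniq ?iota_uniq//; exact: mulrIn.
  by apply/allP => _ /mapP[i _ ->]; have [[]|/negP/negPn] := H i%:R.
by rewrite size_map size_iota ltnn.
Qed.

(** The continuous integrand is positive at some non-root, hence at least half that value on a short
    interval, which already contributes a positive amount. *)
Lemma quartic_functional_gt0 z p : 0 < z -> p != 0 ->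
  (forall x, 0 <= x -> 0 <= p.[x]) -> 0 < quartic_functional z p.
Proof.
move=> z0 pn0 p0; have [x0 x0_ge0 px0] := poly_nonroot_ge0 p pn0.
pose g := weighted z p.
have g0 x : 0 <= x -> 0 <= g x by move=> /p0 ?; rewrite mulr_ge0// expR_ge0.
have gx0 : 0 < g x0.
  by rewrite mulr_gt0 ?expR_gt0// lt_neqAle eq_sym px0 p0.
(* The interval extends only to the right of [x0], so it stays in the half-line even when
   [x0 = 0]. *)
have [d d0 gd] : exists2 d : R, 0 < d &
    forall x : R, x0 <= x <= x0 + d -> g x0 / 2 <= g x.
  have := continuous_weighted z p x0.
  move=> /cvgrPdist_le/(_ (g x0 / 2) (divr_gt0 gx0 (ltr0Sn _ _))).
  move=> /nbhs_ballP[d /= d0 H]; exists (d / 2); first exact: divr_gt0.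
  move=> x /andP[x0x xd]; have /H : ball x0 d x.
    rewrite /ball/= ltr_norml; apply/andP; split; lra.
  rewrite ler_norml => /andP[_]; rewrite -/g; lra.
have mg A : measurable_fun A (EFin \o g).
  apply/measurable_EFinP; apply: measurable_funTS.
  by apply: continuous_measurable_fun; exact: continuous_weighted.
have := integrable_fin_num _ (integrable_weighted z p z0).
rewrite quartic_functionalE /Rintegral => fin.
rewrite -lte_fin fineK; last exact: fin.
have le1 : (0%:E < \int[mu]_(x in `[x0, (x0 + d)%R]) (g x0 / 2)%:E)%E.
  rewrite integral_cst//= lebesgue_measure_itv/= lte_fin ltrDl d0 -EFinB.
  by rewrite addrAC subrr add0r -EFinM lte_fin mulr_gt0// divr_gt0.
apply: (lt_le_trans le1).
apply: (@le_trans _ _ (\int[mu]_(x in `[x0, (x0 + d)%R]) (g x)%:E)%E).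
  apply: ge0_le_integral => //=.
  - by move=> x _; rewrite lee_fin divr_ge0// ltW.
  - exact: mg.
apply: ge0_subset_integral => //=.
- exact: mg.
- by move=> x; rewrite in_itv/= andbT lee_fin => /g0.
- by move=> x /=; rewrite !in_itv/= andbT => /andP[+ _]; exact: le_trans.
Qed.
End Analysis.

(** * Zeros of orthogonal polynomials *)

(** Opposite strict signs at two points of the half-line would force a root strictly between them,
    hence a positive one; a root at [0] does no harm. *)
Lemma constant_sign_ge0 (R : rcfType) (p : {poly R}) :
  (forall x, 0 < x -> ~~ root p x) ->
  (forall x, 0 <= x -> 0 <= p.[x]) \/ (forall x, 0 <= x -> p.[x] <= 0).
Proof.
move=> nr.
suff H a b : 0 <= a -> a < b -> ~~ (p.[a] * p.[b] < 0).
  have [[a a0 pa]|Hn] := pselect (exists2 a, 0 <= a & p.[a] < 0); last first.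
    left=> x x0; rewrite leNgt; apply/negP => px; apply: Hn; by exists x.
  right=> x x0; rewrite leNgt; apply/negP => px.
  have := nmulr_rlt0 p.[x] pa; rewrite px => pax.
  have [ax|xa|ax] := ltgtP a x.
  - by have := H a x a0 ax; rewrite pax.
  - by have := H x a x0 xa; rewrite mulrC pax.
  - by have := lt_trans pa px; rewrite ax ltxx.
move=> a0 ab; apply/negP => pab.
have [x] := polyrcf.poly_ivtoo (ltW ab) pab.
by rewrite in_itv/= => /andP[/(le_lt_trans a0)/nr/negP].
Qed.

(** The construction collects the positive roots of odd multiplicity: each positive root split off
    from [p] toggles its membership in [s]. *)
Lemma roots_fixing_sign (R : rcfType) (p : {poly R}) : p != 0 ->
  exists s : seq R, [/\ uniq s, all (fun x => 0 < x) s, all (root p) s &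
    let q := p * \prod_(x <- s) ('X - x%:P) in
    (forall x, 0 <= x -> 0 <= q.[x]) \/ (forall x, 0 <= x -> q.[x] <= 0)].
Proof.
have [n] := ubnP (size p); elim: n p => // n IHn p; rewrite ltnS => pn p0.
have [[r r0 rp]|Hn] := pselect (exists2 r, 0 < r & root p r); last first.
  exists [::]; split=> //; rewrite big_nil mulr1; apply: constant_sign_ge0.
  by move=> x x0; apply/negP => rx; apply: Hn; exists x.
have /factor_theorem[p' pE] := rp.
have p'0 : p' != 0 by apply: contraNneq p0 => p'0; rewrite pE p'0 mul0r.
have [|s [us s0 rs sgn]] := IHn p' _ p'0.
  by rewrite (leq_trans _ pn)// pE size_Mmonic ?monicXsubC// size_XsubC addn2.
have rsp : all (root p) s.
  by apply/allP => x /(allP rs); rewrite pE rootM => ->.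
have [rs'|rs'] := boolP (r \in s).
  (* The factor taken out of [p] replaces the one dropped from the product, so the polynomial of
     constant sign is unchanged. *)
  exists (rem r s); split.
  - exact: rem_uniq.
  - by apply/allP => x /mem_rem/(allP s0).
  - by apply/allP => x /mem_rem/(allP rsp).
  - rewrite pE -mulrA; suff <- : \prod_(x <- s) ('X - x%:P) =
      ('X - r%:P) * \prod_(x <- rem r s) ('X - x%:P) by [].
    by rewrite (perm_big _ (perm_to_rem rs')) big_cons.
(* Here the polynomial of constant sign is multiplied by the square of ['X - r%:P]. *)
exists (r :: s); split=> /=.
- by rewrite rs'.
- by rewrite r0.
- by rewrite rp.
- rewrite big_cons pE.
  have -> : p' * ('X - r%:P) * (('X - r%:P) * \prod_(x <- s) ('X - x%:P)) =
    ('X - r%:P) ^+ 2 * (p' * \prod_(x <- s) ('X - x%:P)) by ring.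
  case: sgn => sgn; [left|right] => x x0; rewrite hornerM horner_exp.
    by rewrite mulr_ge0 ?sqr_ge0// sgn.
  by rewrite mulr_ge0_le0 ?sqr_ge0// sgn.
Qed.

Section Orthogonal.
Variables (R : realType) (z : R) (P : nat -> {poly R}).
Hypothesis z_gt0 : 0 < z.
Local Notation u := (quartic_functional z).
Hypothesis orthP : monic_orthogonal u P.
Implicit Types (p q r : {poly R}) (n : nat).

Let uD p q : u (p + q) = u p + u q. Proof. exact: quartic_functionalD. Qed.
Let uM c p : u (c%:P * p) = c * u p.
Proof. by rewrite mul_polyC; exact: quartic_functionalZ. Qed.
Let uN p : u (- p) = - u p.
Proof. by rewrite -mulN1r -polyCN uM mulN1r. Qed.

Let u0 : u 0 = 0. Proof. by rewrite -[in LHS](mulr0 0%:P) uM mul0r. Qed.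

Let monicP n : P n \is monic. Proof. by case: orthP. Qed.
Let sizeP n : size (P n) = n.+1. Proof. by case: orthP. Qed.
Let uPP m n : m != n -> u (P m * P n) = 0.
Proof. by case: orthP => _ _ + _; apply. Qed.

(** Induction on the size: [P k] is monic of size [k.+1], so subtracting a multiple of it removes
    the coefficient of degree [k], and that multiple is orthogonal to [P n]. *)
Lemma orthogonal_lower_degree n q : (size q <= n)%N -> u (P n * q) = 0.
Proof.
suff H k : (k <= n)%N -> forall q, (size q <= k)%N -> u (P n * q) = 0.
  by exact: H.
elim: k {q} => [_|k IHk kn] q.
  by rewrite leqn0 size_poly_eq0 => /eqP ->; rewrite mulr0 u0.
move=> qk; have -> :
  P n * q = (q`_k)%:P * (P n * P k) + P n * (q - (q`_k)%:P * P k) by ring.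
rewrite uD uM uPP ?gtn_eqF// mulr0 add0r IHk//; first exact: ltnW.
apply/leq_sizeP => j; rewrite leq_eqVlt => /predU1P[<-|kj].
  rewrite coefB coefCM.
  have := monicP k; rewrite monicE lead_coefE sizeP => /eqP ->.
  by rewrite mulr1 subrr.
rewrite coefB coefCM (nth_default _ (leq_trans qk kj)).
by rewrite (nth_default 0 (_ : (size (P k) <= j)%N)) ?sizeP// mulr0 subrr.
Qed.

Lemma functional_sqr_gt0 q : q != 0 -> 0 < u (q ^+ 2).
Proof.
move=> q0; apply: quartic_functional_gt0 => //; first by rewrite expf_neq0.
by move=> x _; rewrite horner_exp sqr_ge0.
Qed.

(** With fewer than [n] sign-fixing roots, the product of their factors would be orthogonal to
    [P n], although its product with [P n] is nonzero of constant sign. The [n] distinct roots then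
    give the full factorization. *)
Lemma orthogonal_zeros n : exists s : seq R,
  [/\ sorted <%R s, size s = n, all (fun x => 0 < x) s &
      P n = \prod_(x <- s) ('X - x%:P)].
Proof.
have Pn0 : P n != 0 by rewrite -size_poly_eq0 sizeP.
have [s [us s0 rs sgn]] := roots_fixing_sign _ _ Pn0.
have sn : size s = n.
  have := max_poly_roots Pn0 rs us.
  rewrite sizeP ltnS leq_eqVlt => /predU1P[//|sn].
  have pn0 : P n * \prod_(x <- s) ('X - x%:P) != 0.
    by rewrite mulf_neq0// monic_neq0// monic_prod_XsubC.
  have uq0 : u (P n * \prod_(x <- s) ('X - x%:P)) = 0.
    by apply: orthogonal_lower_degree; rewrite size_prod_XsubC.
  case: sgn => sgn.
    by have := quartic_functional_gt0 _ _ _ z_gt0 pn0 sgn; rewrite uq0 ltxx.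
  have := quartic_functional_gt0 _ z (- (P n * \prod_(x <- s) ('X - x%:P))) z_gt0.
  rewrite uN uq0 oppr0 ltxx oppr_eq0 => /(_ pn0); apply: contraPP => _ H.
  by suff : false by []; apply: H => x x0; rewrite hornerN oppr_ge0 sgn.
have perm_s : perm_eq (sort <=%R s) s by rewrite perm_sort.
exists (sort <=%R s); split.
- by rewrite lt_sorted_uniq_le sort_uniq us sort_le_sorted.
- by rewrite size_sort.
- by rewrite all_sort.
- rewrite (perm_big _ perm_s)/= (@all_roots_prod_XsubC _ (P n) s)//.
  + by have /eqP -> := monicP n; rewrite scale1r.
  + by rewrite sizeP sn.
  + by rewrite uniq_rootsE.
Qed.


(** * Recurrence coefficients and deleted zeros *)

Variables (a b : nat -> R).
Hypothesis recP : three_term_recurrence P a b.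
Local Notation h n := (u (P n ^+ 2)).

Lemma functional_mulX_succ n : u ('X * P n * P n.+1) = h n.+1.
Proof.
rewrite recP !mulrDl -!mul_polyC -!mulrA !uD !uM -expr2.
rewrite [u (P n * _)]uPP ?ltn_eqF//.
rewrite mulr0 addr0; case: n => [|n]; first by rewrite mul0r u0 mulr0 addr0.
by rewrite uPP ?mulr0 ?addr0// ltn_eqF.
Qed.

(** The functional of ['X * P n * P n.+1] is computed twice, with the recurrence applied to [P n]
    and to [P n.+1]. *)
Lemma recurrence_coef_succ n : h n.+1 = a n.+1 * h n.
Proof.
rewrite -functional_mulX_succ mulrAC (recP n.+1).
rewrite !mulrDl -!mul_polyC -!mulrA !uD !uM.
have e2 : n.+2 != n by rewrite gtn_eqF// leqnSn.
have e1 : n.+1 != n by rewrite gtn_eqF.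
rewrite (uPP _ _ e2) (uPP _ _ e1).
by rewrite mulr0 !add0r -expr2.
Qed.

Lemma functional_mulX n : u ('X * P n * P n) = b n * h n.
Proof.
rewrite recP !mulrDl -!mul_polyC -!mulrA !uD !uM -expr2 uPP ?gtn_eqF// add0r.
case: n => [|n]; first by rewrite mul0r u0 mulr0 addr0.
by rewrite uPP ?mulr0 ?addr0// ltn_eqF.
Qed.

(** Expanding one factor by the recurrence gives one summand per term. At [n = 0] the last term is
    absent while [a 0] is arbitrary, hence the restriction. *)
Lemma functional_mulX_sqr n : (0 < n)%N ->
  u (('X * P n) ^+ 2) = (a n.+1 + b n ^+ 2 + a n) * h n.
Proof.
case: n => // n _; rewrite expr2 {2}recP !mulrDr -!mul_polyC.
have -> : 'X * P n.+1 * ((b n.+1)%:P * P n.+1) =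
  (b n.+1)%:P * ('X * P n.+1 * P n.+1) by ring.
have -> : 'X * P n.+1 * ((a n.+1)%:P * P n) =
  (a n.+1)%:P * ('X * P n * P n.+1) by ring.
rewrite !uD !uM functional_mulX !functional_mulX_succ.
rewrite (recurrence_coef_succ n.+1).
by ring.
Qed.

(** * Moments of [P n] with one zero deleted *)

Section DeletedZero.
Variables (n : nat) (t : R) (q : {poly R}).
Hypotheses (n_gt0 : (0 < n)%N) (t_neq0 : t != 0).
Hypothesis Pq : P n = ('X - t%:P) * q.

Let q0 : q != 0.
Proof.
by apply/eqP => q0; have := sizeP n; rewrite Pq q0 mulr0 size_poly0.
Qed.

Let sizeq : size q = n.
Proof.
have := sizeP n; rewrite Pq mulrC size_Mmonic ?monicXsubC//.
by rewrite size_XsubC addn2 => -[].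
Qed.

(** Modulo [P n], multiplication by ['X] acts on [q] as the scalar [t]; the moments below are
    reduced this way. *)
Let Xq : 'X * q = P n + t%:P * q. Proof. by rewrite Pq; ring. Qed.

Let uPq : u (P n * q) = 0.
Proof. by apply: orthogonal_lower_degree; rewrite sizeq. Qed.

Let uPXq : u (P n * ('X * q)) = h n.
Proof.
have -> : P n * ('X * q) = P n ^+ 2 + t%:P * (P n * q) by rewrite Xq; ring.
by rewrite uD uM uPq mulr0 addr0.
Qed.

Let uPXXq : u (P n * ('X * ('X * q))) = (b n + t) * h n.
Proof.
have -> : P n * ('X * ('X * q)) = 'X * P n * P n + t%:P * (P n * ('X * q)).
  by rewrite [X in 'X * X]Xq; ring.
by rewrite uD uM uPXq functional_mulX mulrDl.
Qed.

(* [q] is a multiple of the reproducing kernel at [t]. *)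
Let uqr r : (size r <= n)%N -> u (q * r) = u q * r.[t].
Proof.
(* With [r - r(t) = r' (X - t)], the product [q r] is [r(t) q + P n r'], and the last term is killed
   by orthogonality. *)
move=> rn; have /factor_theorem[r' rE] : root (r - (r.[t])%:P) t.
  by rewrite rootE !hornerE subrr.
have -> : q * r = (r.[t])%:P * q + P n * r'.
  have -> : r = (r.[t])%:P + r' * ('X - t%:P) by rewrite -rE addrC subrK.
  by rewrite hornerD hornerM hornerXsubC subrr mulr0 addr0 !hornerC Pq; ring.
rewrite uD uM orthogonal_lower_degree ?addr0 1?mulrC//.
have [->|r'0] := eqVneq r' 0; first by rewrite size_poly0.
rewrite -ltnS; have := size_Mmonic r'0 (monicXsubC t).
rewrite size_XsubC addn2 /= => <-; rewrite -rE.
apply: leq_trans (size_polyD _ _) _; rewrite size_polyN geq_max leqW//=.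
by apply: leq_trans (size_polyC_leq1 _) _.
Qed.

Let uqq : u (q ^+ 2) = u q * q.[t].
Proof. by rewrite expr2 uqr// sizeq. Qed.

Let size_deriv_le r m : (size r <= m.+1)%N -> (size r^`() <= m)%N.
Proof.
move=> rm; have [->|r0] := eqVneq r 0; first by rewrite deriv0 size_poly0.
by rewrite -ltnS; apply: leq_trans rm; exact: lt_size_deriv.
Qed.

Let P0q0 : (P n).[0] = - t * q.[0].
Proof. by rewrite Pq hornerM hornerXsubC sub0r. Qed.

(** Integration by parts for [q * P n]: the term with the derivative of [q] vanishes, the other is
    [u q] times the derivative of [P n] at [t], which is [q.[t]]. The boundary term gives [(P n).[0]
    ^+ 2 / t]. *)
Lemma deleted_zero_norm : u (q ^+ 2) =
  4 * z * h n * (t ^+ 2 + b n * t + a n.+1 + b n ^+ 2 + a n)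
  + (P n).[0] ^+ 2 / t.
Proof.
have uqP' : u (q * (P n)^`()) = u (q ^+ 2).
  rewrite uqr ?size_deriv_le ?sizeP// uqq Pq derivM derivXsubC mul1r hornerD.
  by rewrite hornerM hornerXsubC subrr mul0r addr0.
have uq'P : u (P n * q^`()) = 0.
  by apply: orthogonal_lower_degree; rewrite size_deriv_le ?sizeq.
have := quartic_functional_deriv _ _ (q * P n) z_gt0.
rewrite derivM uD [q^`() * _]mulrC uq'P add0r uqP' => ->.
have -> : 'X^3 * (q * P n) = ('X * P n) ^+ 2 + t%:P * (P n * ('X * ('X * q))).
  have -> : 'X^3 * (q * P n) = 'X ^+ 2 * ('X * q) * P n by ring.
  by rewrite {1}Xq; ring.
rewrite uD uM uPXXq functional_mulX_sqr// hornerM P0q0.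
by field.
Qed.

(** Integration by parts for [q ^+ 2], multiplied by [q.[t]] so that [u q * q.[t]] becomes
    [u (q ^+ 2)]. *)
Lemma deleted_zero_log_derivative :
  2 * q^`().[t] * u (q ^+ 2) = q.[t] *
   (4 * z * t ^+ 3 * u (q ^+ 2) + 4 * z * h n * (b n + 2 * t)
    - (P n).[0] ^+ 2 / t ^+ 2).
Proof.
have uqq' : u (q * q^`()) = u q * q^`().[t].
  by rewrite uqr// size_deriv_le// sizeq.
have := quartic_functional_deriv _ _ (q ^+ 2) z_gt0.
have -> : 'X^3 * q ^+ 2 = P n * ('X * ('X * q)) + t%:P * (P n * ('X * q))
    + (t ^+ 2)%:P * (P n * q) + (t ^+ 3)%:P * q ^+ 2.
  by rewrite Pq !rmorphXn/=; ring.
have -> : (q ^+ 2)^`() = 2%:P * (q * q^`()) by rewrite expr2 derivM; ring.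
rewrite !uD !uM uPXXq uPXq uPq uqq' horner_exp => E.
have -> : 2 * q^`().[t] * u (q ^+ 2) = q.[t] * (2 * (u q * q^`().[t])).
  by rewrite uqq; ring.
by rewrite E P0q0; field.
Qed.

End DeletedZero.

End Orthogonal.

(** * Derivative of the energy *)

Section Energy.
Local Open Scope classical_set_scope.
Local Open Scope ring_scope.
Variable R : realType.

(** Reduces the partial derivatives of the energy to one-variable calculus. *)
Lemma is_derive_line (V : normedModType R) (f : V -> R) (x v : V) (d : R) :
  is_derive (0 : R) 1 (fun s : R => f (s *: v + x)) d -> is_derive x v f d.
Proof.
move=> [df <-]; split; first by apply/derivable1P.
rewrite /derive; set g1 := fun h => h^-1 *: _; set g2 := fun h => h^-1 *: _.
suff -> : g1 = g2 by [].
by apply/funext => s; rewrite /g1 /g2 /= addr0 scale0r add0r [_%:A]mulr1.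
Qed.

Lemma is_derive_sum_ord n (P : pred 'I_n) (f : 'I_n -> R -> R) (df : 'I_n -> R)
    (x : R) : (forall i, P i -> is_derive x 1 (f i) (df i)) ->
  is_derive x 1 (fun s => \sum_(i < n | P i) f i s) (\sum_(i < n | P i) df i).
Proof.
move=> H; rewrite big_mkcond/=.
under eq_fun do rewrite big_mkcond/=.
have := @is_derive_sum _ _ _ n (fun i s => if P i then f i s else 0) x 1
  (fun i => if P i then df i else 0).
rewrite fct_sumE; apply => i; case: (boolP (P i)) => Pi; first exact: H.
exact: is_derive_cst.
Qed.

(* [ln] vanishes at [0], so [ln `|x| = ln (x ^+ 2) / 2] holds everywhere. *)
Lemma is_derive_ln_norm (f : R -> R) (x d : R) :
  is_derive x 1 f d -> f x != 0 -> is_derive x 1 (fun s => ln `|f s|) (d / f x).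
Proof.
move=> df fx0.
have -> : (fun s => ln `|f s|) = 2^-1 *: (@ln R \o (f ^+ 2)).
  apply/funext => s; rewrite /GRing.scale/= exprfctE.
  have [->|fs0] := eqVneq (f s) 0.
    by rewrite normr0 expr0n/= ln0// scaler0.
  rewrite -real_normK ?num_real// lnXn ?normr_gt0//.
  by rewrite -[_ *: _]/(_ * _); field.
have h : 0 < (f ^+ 2) x by rewrite exprfctE exprn_even_gt0.
have h2 : is_derive x 1 (f ^+ 2) (2 * f x * d).
  by apply: is_derive_eq (is_deriveX 2 df) _; rewrite expr1.
apply: is_derive_eq (is_deriveZ 2^-1 (is_derive1_comp (is_derive1_ln h) h2)) _.
by rewrite exprfctE -[_ *: _]/(_ * _); field.
Qed.

Lemma is_derive_affine (x c s : R) : is_derive s 1 (fun s => x + s * c) c.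
Proof.
apply: is_derive_eq (is_deriveD (is_derive_cst x s 1)
  (is_deriveM (is_derive_id s 1) (is_derive_cst c s 1))) _.
by rewrite scaler0 !add0r /GRing.scale/= mulr1.
Qed.

Lemma is_derive_energy n (V : R -> R) (dV : 'I_n -> R)
    (y : 'rV[R]_n) (k : 'I_n) :
  injective (y 0) -> (forall i, is_derive (y 0 i) 1 V (dV i)) ->
  is_derive y (delta_mx 0 k : 'rV[R]_n) (total_energy V)
    (dV k - 2 * \sum_(j < n | j != k) (y 0 k - y 0 j)^-1).
Proof.
move=> yI HV; apply: is_derive_line.
(* Coordinate [i] moves with speed [c i], so the difference of coordinates [i] and [j] moves with
   speed [c i - c j]. *)
pose c (i : 'I_n) : R := (i == k)%:R.
have -> : (fun s : R => total_energy V (s *: delta_mx 0 k + y)) =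
  (- 2) *: (fun s => \sum_(j < n) \sum_(i < n | (j < i)%N)
      ln `|(y 0 i - y 0 j) + s * (c i - c j)|)
  + (fun s => \sum_(i < n) V (y 0 i + s * c i)).
  apply/funext => s; rewrite /total_energy; congr (_ * _ + _).
    apply: eq_bigr => j _; apply: eq_bigr => i _; congr (ln `| _ |).
    by rewrite !mxE/= /c; ring.
  by apply: eq_bigr => i _; rewrite !mxE/= addrC.
have H1 := @is_derive_sum_ord n xpredT
  (fun j s => \sum_(i < n | (j < i)%N) ln `|(y 0 i - y 0 j) + s * (c i - c j)|)
  (fun j => \sum_(i < n | (j < i)%N) (c i - c j) / (y 0 i - y 0 j)) 0.
have H2 := @is_derive_sum_ord n xpredT (fun i s => V (y 0 i + s * c i))
  (fun i => dV i * c i) 0.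
apply: is_derive_eq (is_deriveD (is_deriveZ (- 2) (H1 _)) (H2 _)) _.
- move=> j _; apply: is_derive_sum_ord => i ij.
  have yij : y 0 i - y 0 j != 0.
    by rewrite subr_eq0; apply: contraTneq ij => /yI ->; rewrite ltnn.
  have := is_derive_ln_norm _ _ _ (is_derive_affine (y 0 i - y 0 j) (c i - c j) 0).
  by rewrite mul0r addr0; apply.
- move=> i _; apply: is_derive1_comp; last exact: is_derive_affine.
  by rewrite mul0r addr0.
rewrite /GRing.scale/= [RHS]addrC mulNr; congr (- (2 * _) + _).
(* Splitting [c i - c j] and renaming indices in the second half leaves only numerators [c i]; then
   only [i = k] survives, paired with [j < k] in one sum and [j > k] in the other. *)
- have -> : \sum_(j < n) \sum_(i < n | (j < i)%N) (c i - c j) / (y 0 i - y 0 j) =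
    \sum_(j < n) \sum_(i < n | (j < i)%N) c i / (y 0 i - y 0 j) +
    \sum_(i < n) \sum_(j < n | (i < j)%N) c i / (y 0 i - y 0 j).
    rewrite -big_split; apply: eq_bigr => j _; rewrite -big_split.
    apply: eq_bigr => i _ /=; rewrite mulrBl -[y 0 j - y 0 i]opprB invrN mulrN.
    by [].
  rewrite (exchange_big_dep xpredT)//= -big_split/= (bigD1 k)//=.
  rewrite [X in _ + X]big1 ?addr0; last first.
    move=> i /negPf ik; rewrite /c ik.
    by rewrite !big1 ?addr0// => j _; rewrite mul0r.
  rewrite /c eqxx [RHS](bigID (fun j : 'I_n => (j < k)%N))/=.
  congr (_ + _); apply: eq_big => j.
  + by rewrite andb_idl// => jk; rewrite neq_ltn jk.
  + by rewrite mul1r.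
  + by rewrite -leqNgt neq_ltn andb_orl; case: ltngtP.
  + by rewrite mul1r.
- rewrite (bigD1 k)//= /c eqxx mulr1 big1 ?addr0// => i /negPf ->.
  by rewrite mulr0.
Qed.

(** The logarithmic derivative in multiplied-out form; it turns the derivative of the deleted
    polynomial into the sum of repulsions from the other zeros. *)
Lemma log_deriv_prod_XsubC (I : finType) (A : pred I) (x : I -> R) (t : R) :
  (forall i, A i -> t != x i) ->
  (\prod_(i | A i) ('X - (x i)%:P))^`().[t] =
  (\prod_(i | A i) ('X - (x i)%:P)).[t] * \sum_(i | A i) (t - x i)^-1.
Proof.
move=> tx; elim/big_rec2 : _ => [|i s p Ai IH].
  by rewrite derivC horner0 mulr0.
rewrite derivM derivXsubC !hornerE IH.
have : t - x i != 0 by rewrite subr_eq0 tx.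
by move=> H; field.
Qed.

End Energy.

(** * Zeros as equilibrium positions *)

Theorem theorem7p4 (R : realType) (z : R) (hz : 0 < z)
    (P : nat -> {poly R}) (a b h : nat -> R)
    (hP : monic_orthogonal (quartic_functional z) P)
    (hab : three_term_recurrence P a b)
    (hh : forall n, h n = quartic_functional z (P n ^+ 2))
    (n : nat) (hn : (1 <= n)%N) :
  exists x : 'rV[R]_n,
    [/\ ordered_zeros (P n) x,
        forall k : 'I_n, 0 < x 0 k
      & critical_point (total_energy (external_potential z P a b h n)) x].
Proof.
have [monP _ _ _] := hP.
have [s [s_sorted size_s s_gt0 PE]] := orthogonal_zeros R z P hz hP n.
pose x := (\row_(i < n) s`_i) : 'rV[R]_n.
have xE i : x 0 i = s`_i by rewrite mxE.
have s_i (i : 'I_n) : (i < size s)%N by rewrite size_s.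
have x_gt0 i : 0 < x 0 i by rewrite xE; apply: (allP s_gt0); exact: mem_nth.
have x_inj : injective (x 0).
  move=> i j; rewrite !xE => /eqP; rewrite nth_uniq ?s_i ?lt_sorted_uniq//.
  by move=> /eqP/val_inj.
exists x; split=> //.
  split=> [j k jk|t]; first by rewrite !xE lt_sorted_ltn_nth ?inE.
  rewrite PE root_prod_XsubC; split=> [/(nthP 0)[i si <-]|[k ->]]; last first.
    by rewrite xE mem_nth.
  by move: si; rewrite size_s => si; exists (Ordinal si); rewrite xE.
have {}PE : P n = \prod_(i < n) ('X - (x 0 i)%:P).
  by rewrite PE (big_nth 0) big_mkord size_s; apply: eq_bigr => i _; rewrite xE.
have h_gt0 : 0 < h n.
  by rewrite hh; apply: functional_sqr_gt0 => //; exact: monic_neq0.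
pose e := a n.+1 + b n ^+ 2 + a n; pose c := (P n).[0] ^+ 2 / (4 * z * h n).
(* [Phi] is the polynomial inside the logarithm of the potential. *)
pose Phi := 'X^3 + b n *: 'X^2 + e *: 'X + c%:P.
have PhiE t : Phi.[t] = t * (t ^+ 2 + b n * t + a n.+1 + b n ^+ 2 + a n) + c.
  by rewrite !hornerD !hornerZ !hornerXn hornerX hornerC /e; ring.
pose q i := \prod_(j < n | j != i) ('X - (x 0 j)%:P).
have Pq i : P n = ('X - (x 0 i)%:P) * q i by rewrite PE (bigD1 i).
have q_norm i : quartic_functional z (q i ^+ 2) =
    4 * z * h n * Phi.[x 0 i] / x 0 i.
  have x0 : x 0 i != 0 by rewrite gt_eqF.
  rewrite (deleted_zero_norm R z P hz hP a b hab n (x 0 i) (q i)) // PhiE -hh /c.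
  by field; rewrite x0 !gt_eqF.
have q_norm_gt0 i : 0 < quartic_functional z (q i ^+ 2).
  apply: functional_sqr_gt0 => //; apply/monic_neq0.
  by apply: monic_prod => j _; exact: monicXsubC.
(* Positivity of the norm of [q i] keeps the zeros of [P n] away from the singularities of the
   logarithm of [Phi]. *)
have Phi0 i : Phi.[x 0 i] != 0.
  apply: contraTneq (q_norm_gt0 i) => Phi0.
  by rewrite q_norm Phi0 mulr0 mul0r ltxx.
have VE : external_potential z P a b h n =
    (fun t => z * t ^+ 4 + ln `|Phi.[t]|) - (fun t => ln `|t|).
  by apply/funext => t; rewrite /external_potential -/c -PhiE.
have dV (i : 'I_n) : is_derive (x 0 i) 1 (external_potential z P a b h n)
    (4 * z * x 0 i ^+ 3 + Phi^`().[x 0 i] / Phi.[x 0 i] - (x 0 i)^-1).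
  have x0 : x 0 i != 0 by rewrite gt_eqF.
  rewrite VE; apply: is_derive_eq (is_deriveB (is_deriveD
    (is_deriveZ z (is_deriveX 4 (is_derive_id _ _)))
    (is_derive_ln_norm _ _ _ _ (is_derive_poly Phi _) (Phi0 i)))
    (is_derive_ln_norm _ _ _ _ (is_derive_id _ _) x0)) _.
  by rewrite -![_ *: _]/(_ * _) mulr1 div1r mulrA [z * 4]mulrC.
move=> k; apply: is_derive_eq (is_derive_energy _ _ _ _ _ k x_inj dV) _.
(* What remains is that the derivative of the potential at [t] equals [2 * S]. *)
set t := x 0 k; set S := \sum_(j < n | _) _.
have t0 : t != 0 := lt0r_neq0 (x_gt0 k).
have tx j : j != k -> t != x 0 j.
  by apply: contra_neq => /x_inj ->.
have dq : (q k)^`().[t] = (q k).[t] * S by exact: log_deriv_prod_XsubC.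
have qt0 : (q k).[t] != 0.
  rewrite horner_prod prodf_seq_neq0; apply/allP => j _; apply/implyP => /tx.
  by rewrite hornerXsubC subr_eq0.
have := deleted_zero_log_derivative R z P hz hP a b hab n t (q k) t0 (Pq k).
rewrite dq -hh => E.
(* Cancel [q(t)] and express the norm of [q k] through [Phi]. *)
have {}E : 2 * S * (4 * z * h n * Phi.[t] / t) =
    4 * z * t ^+ 3 * (4 * z * h n * Phi.[t] / t)
    + 4 * z * h n * (b n + 2 * t) - (P n).[0] ^+ 2 / t ^+ 2.
  by apply: (mulfI qt0); rewrite -q_norm -E; ring.
have PhiD : Phi^`().[t] = 3 * t ^+ 2 + 2 * b n * t + e.
  rewrite /Phi !derivD !derivZ !derivXn derivX derivC addr0 !hornerD !hornerZ.
  by rewrite !hornerMn !hornerXn hornerC; ring.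
have F0 : Phi.[t] != 0 := Phi0 k.
(* This is the numerator of [Phi'/Phi - 1/t] over the denominator [t Phi(t)]. *)
have num : (b n + 2 * t) * t ^+ 2 - c = Phi^`().[t] * t - Phi.[t].
  by rewrite PhiD PhiE /e; ring.
have p0E : (P n).[0] ^+ 2 = 4 * z * h n * c.
  by rewrite /c; field; rewrite !gt_eqF.
have h0 : h n != 0 by rewrite gt_eqF.
have z0 : z != 0 by rewrite gt_eqF.
(* Dividing [E] by the norm of [q k] eliminates [h n]. *)
have -> : 2 * S = 4 * z * t ^+ 3 + ((b n + 2 * t) * t ^+ 2 - c) / (t * Phi.[t]).
  have U0 : 4 * z * h n * Phi.[t] / t != 0.
    by rewrite !mulf_neq0 ?invr_neq0// pnatr_eq0.
  apply: (mulIf U0); rewrite E p0E.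
  by field; rewrite t0 F0.
by rewrite num; field; rewrite t0 F0.
Qed.
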